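(* Let $N(t)$, $t\ge0$, be a homogeneous Poisson process of rate $\lambda>0$, let $\alpha>0$, and let $$\mathcal N^\alpha(t)=\frac1{\Gamma(\alpha)}\int_0^t(t-s)^{\alpha-1}N(s)\,\mathrm ds,\qquad t\ge0 .$$ Then for all $t\ge0$, $$\operatorname{Var}\,\mathcal N^\alpha(t)=\frac{\lambda t^{2\alpha+1}}{(2\alpha+1)\,\Gamma^2(\alpha+1)} .$$
   Context: Here $\Gamma^2(x)=(\Gamma(x))^2$. The process $\mathcal N^\alpha(t)$ is the Riemann--Liouville fractional integral of order $\alpha$ of the Poisson process paths. *)

(* Defs.v *)
From HB Require Import structures.
From mathcomp Require Import all_boot all_order all_algebra.
From mathcomp Require Import all_classical all_reals all_analysis.

Set Implicit Arguments.
Unset Strict Implicit.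
Unset Printing Implicit Defensive.

Import Order.TTheory GRing.Theory Num.Theory.
Import numFieldNormedType.Exports.

Local Open Scope classical_set_scope.
Local Open Scope ring_scope.

Definition Gamma (R : realType) (x : R) : R :=
  \int[@lebesgue_measure R]_(u in `]0, +oo[) (u `^ (x - 1) * expR (- u)).

Definition riemann_liouville (R : realType) (alpha : R) (f : R -> R) (t : R)
    : R :=
  (Gamma alpha)^-1 *
  \int[@lebesgue_measure R]_(s in `[0, t]) ((t - s) `^ (alpha - 1) * f s).

(* The index type is finite, so the product rule for the full family suffices:
   subfamilies are recovered by taking some of the A i equal to setT. *)
Definition mutually_independent d d' (T : measurableType d)
    (T' : measurableType d') (R : realType) (P : probability T R)
    (I : finType) (X : I -> T -> T') : Prop :=
  forall A : I -> set T', (forall i, measurable (A i)) ->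
    P [set w | forall i, A i (X i w)] = (\prod_(i : I) P (X i @^-1` A i))%E.

(* Only times t >= 0 are constrained. The truncated subtraction on nat is exact
   on the increments below since the paths are nondecreasing. *)
Record poisson_process d (T : measurableType d) (R : realType)
    (P : probability T R) (lambda : R) (N : R -> {RV P >-> nat}) : Prop :=
  PoissonProcess {
    poisson_start : forall w, N 0 w = 0%N ;
    poisson_nondecreasing : forall w (s t : R),
      0 <= s -> s <= t -> (N s w <= N t w)%N ;
    poisson_right_continuous : forall w (t : R), 0 <= t ->
      N s w @[s --> t^'+] --> N t w ;
    poisson_independent_increments : forall (n : nat) (t : nat -> R),
      0 <= t 0%N -> (forall i, t i <= t i.+1) ->
      mutually_independent P
        (fun (i : 'I_n) (w : T) => (N (t i.+1) w - N (t i) w)%N) ;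
    poisson_increments : forall (s t : R), 0 <= s -> s < t -> forall k : nat,
      P [set w | (N t w - N s w)%N = k] =
        (poisson_pmf (lambda * (t - s)) k)%:E
  }.

(* Main.v *)
Require Import Defs.
From HB Require Import structures.
From mathcomp Require Import all_boot all_order all_algebra.
From mathcomp Require Import all_classical all_reals all_analysis.
From mathcomp Require Import measurable_realfun.
From mathcomp Require Import ring lra.
Import Order.TTheory GRing.Theory Num.Theory.
Import numFieldNormedType.Exports.
Local Open Scope classical_set_scope.
Local Open Scope ring_scope.
Set Implicit Arguments.
Unset Strict Implicit.
Unset Printing Implicit Defensive.

(** Put k(s) = (t - s)^(alpha-1) on [0, t] and let
    J = int_0^t k(s) N(s) ds, so that the process at time t is J / Gamma(alpha).

    The variance of J is the double integral of k(s) k(u) Cov(N(s), N(u)), and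
    independence of increments gives Cov(N(s), N(u)) = lambda min(s, u).
    Writing min(s, u) as the length of the set of v in [0, t] below both s and
    u and exchanging integrals turns
      int int k(s) k(u) min(s, u) du ds
    into the integral over v of K(v)^2, where K(v) is the integral of k over
    [v, t], that is (t - v)^alpha / alpha.  This is
    t^(2 alpha + 1) / ((2 alpha + 1) alpha^2)
    ([riemann_liouville_min_kernel]), and alpha Gamma(alpha) = Gamma(alpha + 1)
    ([Gamma_recurrence]) absorbs the factor alpha^2.

    All exchanges of integrals, on R x R as well as on Omega x [0, t], are
    instances of one form of Tonelli's theorem for an integral operator and its
    transpose ([tonelli_kernel]).  On Omega x [0, t] it requires the process to
    be jointly measurable; this follows from right continuity and monotonicity
    of the paths ([measurable_poisson_process]).  The second moments of the
    Poisson process come from the identity E[X f(X)] = m E[f(X + 1)], which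
    holds for X Poisson of mean m ([poisson_stein]). *)

(** * Power functions and a fundamental theorem of calculus with singular endpoints *)

(** For alpha < 1 the integrand (t - s)^(alpha-1) blows up at s = t, so the
    fundamental theorem of calculus on closed intervals does not apply.  For a
    nonnegative integrand it is enough to be continuous inside the interval:
    monotone convergence along closed subintervals exhausting the open interval
    reduces the claim to continuity of the antiderivative at the endpoints. *)
Lemma ge0_FTC2_oo (R : realType) (f F : R -> R) (a b : R) : a < b ->
  (forall x, a < x < b -> 0 <= f x) ->
  (forall x, a < x < b -> {for x, continuous f}) ->
  derivable_oo_LRcontinuous F a b ->
  {in `]a, b[, F^`()%classic =1 f} ->
  (\int[@lebesgue_measure R]_(x in `[a, b]) (f x)%:E = (F b - F a)%:E)%E.
Proof.
move=> ab f0 cf [dF Fa Fb] F'f.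
have mf : measurable_fun `]a, b[ f.
  apply: subspace_continuous_measurable_fun => //.
  by apply: continuous_in_subspaceT => x; rewrite inE/= in_itv/=; exact: cf.
rewrite integral_itv_bndoo; last exact/measurable_EFinP.
(* With e n at most a third of b - a, the interval [a + e n, b - e n] never
   degenerates. *)
pose e (n : nat) : R := (b - a) / 3 * harmonic n.
have ba : 0 < b - a by rewrite subr_gt0.
have e_gt0 n : 0 < e n by rewrite mulr_gt0 ?harmonic_gt0// divr_gt0.
have e_le n : e n <= (b - a) / 3.
  apply: ler_piMr; first by rewrite divr_ge0 ?ltW.
  rewrite /harmonic/=.
  by rewrite invf_le1 ?ler1n.
have e_nincr m n : (m <= n)%N -> e n <= e m.
  by move=> mn; rewrite ler_pM2l ?divr_gt0//= lef_pV2 ?posrE// ler_nat.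
have e_cvg : e n @[n --> \oo] --> (0 : R).
  by rewrite -(mulr0 ((b - a) / 3)); apply: cvgMr; exact: cvg_harmonic.
pose I n := `[a + e n, b - e n]%classic : set R.
have sub n (x : R) : x \in `[a + e n, b - e n] -> a < x < b.
  rewrite in_itv/= => /andP[h1 h2]; have := e_gt0 n; lra.
have IU : `]a, b[%classic = \bigcup_n I n.
  apply/seteqP; split => [x|x [n _ /sub]]; last by rewrite /= in_itv.
  rewrite /= in_itv/=.
  move=> /andP[ax xb].
  have : \forall n \near \oo, e n < Num.min (x - a) (b - x).
    apply: (cvgr_lt _ e_cvg); rewrite lt_min !subr_gt0 ax//.
  case=> n _ /(_ n (leqnn _)); rewrite lt_min => /andP[h1 h2].
  by exists n => //; rewrite /I/= in_itv/=; apply/andP; split; lra.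
rewrite IU.
have cvgI : (\int[@lebesgue_measure R]_(x in I n) (f x)%:E @[n --> \oo] -->
    \int[@lebesgue_measure R]_(x in \bigcup_n I n) (f x)%:E)%E.
  apply: ge0_nondecreasing_set_cvg_integral => //=.
  - move=> m n mn; apply/subsetPset => x; rewrite /I/= !in_itv/=.
    by move=> /andP[h1 h2]; have := e_nincr _ _ mn; lra.
  - by move=> n; exact: measurable_itv.
  - move=> n; apply/measurable_EFinP; apply: measurable_funS mf => // x.
    by move=> /sub; rewrite /= in_itv.
  - by move=> n x /sub /f0; rewrite lee_fin.
apply/esym; apply: cvg_unique cvgI => //.
rewrite (_ : (fun n => _) = (fun n => (F (b - e n) - F (a + e n))%:E)); last first.
  apply/funext => n; rewrite /I EFinB (@continuous_FTC2 _ f F)//.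
  - by have := e_le n; lra.
  - apply: continuous_in_subspaceT => x; rewrite inE => /sub; exact: cf.
  - have dF' x : a < x < b -> {for x, continuous F}.
      move=> h; apply/differentiable_continuous/derivable1_diffP.
      by apply: dF; rewrite in_itv.
    have := e_gt0 n; have := e_le n => h1 h2.
    split.
    + move=> x xe; apply: dF; rewrite in_itv/=; apply: sub (n) _ _.
      by apply: subset_itv_oo_cc.
    + by apply/cvg_at_right_filter/dF'; lra.
    + by apply/cvg_at_left_filter/dF'; lra.
  - move=> x xe; apply: F'f; rewrite in_itv/=; apply: sub (n) _ _.
    by apply: subset_itv_oo_cc.
apply: cvg_EFin; first exact: nearW.
apply: cvgB.
- move/cvg_at_leftP: Fb; apply; split=> [n|]; first by have := e_gt0 n; lra.
  by rewrite -[X in _ --> X]subr0; apply: cvgB => //; exact: cvg_cst.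
- move/cvg_at_rightP: Fa; apply; split=> [n|]; first by have := e_gt0 n; lra.
  by rewrite -[X in _ --> X]addr0; apply: cvgD => //; exact: cvg_cst.
Qed.

Lemma continuous_powR (R : realType) (p x : R) : 0 < x ->
  {for x, continuous (fun y : R => y `^ p)}.
Proof.
move=> x0; apply/differentiable_continuous/derivable1_diffP.
by apply: derivable_powR; rewrite in_itv/= andbT.
Qed.

Lemma integral_powR0 (R : realType) (p u : R) : 0 < p -> 0 <= u ->
  (\int[@lebesgue_measure R]_(x in `[0%R, u]) (x `^ (p - 1))%R%:E
    = (u `^ p / p)%R%:E)%E.
Proof.
move=> p0; rewrite le_eqVlt => /predU1P[<-|u0].
  by rewrite set_itv1 integral_set1 powR0 ?gt_eqF// mul0r.
rewrite (@ge0_FTC2_oo _ _ (fun x => x `^ p / p))//.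
- by rewrite powR0 ?gt_eqF// mul0r subr0.
- by move=> x _; exact: powR_ge0.
- by move=> x /andP[x0 _]; exact: continuous_powR.
- split.
  + move=> x; rewrite in_itv/= => /andP[x0 _].
    by apply: derivableM => //; apply: derivable_powR; rewrite in_itv/= andbT.
  + by apply: cvgMl; rewrite powR0 ?gt_eqF//; exact: powR_cvg0.
  + by apply: cvgMl; apply: cvg_at_left_filter; exact: continuous_powR.
- move=> x; rewrite in_itv/= => /andP[x0 _].
  rewrite derive1E; have dx := is_derive1_powR p x0.
  rewrite deriveM// derive_cst derive_val scaler0 add0r /GRing.scale/=.
  by rewrite mulrA mulVf ?mul1r// gt_eqF.
Qed.

Lemma integral_powR_sub (R : realType) (p v t : R) : 0 < p -> v <= t ->
  (\int[@lebesgue_measure R]_(s in `[v, t]) ((t - s) `^ (p - 1))%R%:E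
    = ((t - v) `^ p / p)%R%:E)%E.
Proof.
move=> p0; rewrite le_eqVlt => /predU1P[<-|vt].
  by rewrite set_itv1 integral_set1 subrr powR0 ?gt_eqF// mul0r.
have dF (s : R) : s < t ->
    is_derive s 1 (- p^-1 \*: ((@powR R ^~ p) \o (fun s => t - s))) ((t - s) `^ (p - 1)).
  move=> st; have dp : is_derive (t - s) 1 (@powR R ^~ p) (p * (t - s) `^ (p - 1)).
    by apply: is_derive1_powR; rewrite subr_gt0.
  have dts : is_derive s 1 (fun s => t - s) (- 1).
    rewrite -[X in is_derive _ _ _ X]sub0r.
    exact: (is_deriveB (is_derive_cst t s 1) (is_derive_id s 1)).
  apply: is_derive_eq.
  by rewrite /GRing.scale/= mulrN1 mulrN mulrA mulNr mulVf ?gt_eqF// mulN1r opprK.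
rewrite (@ge0_FTC2_oo _ _ (- p^-1 \*: ((@powR R ^~ p) \o (fun s => t - s))))//.
- by rewrite /= subrr powR0 ?gt_eqF// scaler0 sub0r scaleNr opprK /GRing.scale/= mulrC.
- by move=> x _; exact: powR_ge0.
- move=> x /andP[_ xt]; apply: (@continuous_comp _ _ _ (fun s => t - s) (@powR R ^~ (p - 1))).
    by apply: cvgB => //; exact: cvg_cst.
  by apply: continuous_powR; rewrite subr_gt0.
- split.
  + by move=> x; rewrite in_itv/= => /andP[_ /dF].
  + by apply: cvg_at_right_filter; apply/differentiable_continuous/derivable1_diffP; have := dF _ vt.
  + apply/cvg_at_leftP => u [ut cu]; apply: cvgZr => /=.
    rewrite subrr powR0 ?gt_eqF//.
    have /cvg_at_rightP := powR_cvg0 p0; apply; split=> [n|].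
      by rewrite subr_gt0.
    by rewrite -(subrr t); apply: cvgB => //; exact: cvg_cst.
- by move=> x; rewrite in_itv/= => /andP[_ /dF d]; rewrite derive1E derive_val.
Qed.

Lemma measurable_powR_sub (R : realType) (p t : R) (A : set R) :
  measurable_fun A (fun s => (t - s) `^ p).
Proof.
apply: measurable_funTS; apply: (measurableT_comp (measurable_powR p)).
by apply: continuous_measurable_fun => x; apply: cvgB => //; exact: cvg_cst.
Qed.

(** * Tonelli's theorem for integral operators *)

Section tonelli_kernel.
Local Open Scope ereal_scope.
Context d1 d2 (T1 : measurableType d1) (T2 : measurableType d2) (R : realType).
Variables (m1 : {sigma_finite_measure set T1 -> \bar R})
          (m2 : {sigma_finite_measure set T2 -> \bar R}).
Variables (D1 : set T1) (D2 : set T2) (h : T1 * T2 -> \bar R).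
Hypotheses (mD1 : measurable D1) (mD2 : measurable D2).
Hypothesis mh : measurable_fun (D1 `*` D2) h.
Hypothesis h0 : forall x y, D1 x -> D2 y -> 0 <= h (x, y).

Lemma measurable_fun_integral_kernel (g : T2 -> \bar R) :
  measurable_fun D2 g -> (forall y, D2 y -> 0 <= g y) ->
  measurable_fun D1 (fun x => \int[m2]_(y in D2) (h (x, y) * g y)).
Proof.
move=> mg g0; apply/(measurable_restrictT _ mD1).
pose H := (fun z : T1 * T2 => h z * g z.2) \_ (D1 `*` D2).
have mH : measurable_fun setT H.
  apply/(measurable_restrictT _ (measurableX mD1 mD2)).
  apply: emeasurable_funM => //.
  apply: (@measurable_comp _ _ _ _ _ _ D2) => //.
    by move=> _ [z [_ ? ] <-].
  by apply: measurable_funTS; exact: measurable_snd.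
have H0 z : 0 <= H z.
  by apply: erestrict_ge0 => -[x y] [/= ? ?]; rewrite mule_ge0 ?h0 ?g0.
rewrite [X in measurable_fun _ X](_ : _ = fubini_F m2 H).
  exact: measurable_fun_fubini_tonelli_F.
apply/funext => x; rewrite patchE /fubini_F; case: ifPn => xD1.
  rewrite [LHS]integral_mkcond; apply: eq_integral => y _; rewrite /H !patchE in_setX xD1.
  by [].
by rewrite integral0_eq// => y _; rewrite /H patchE in_setX (negbTE xD1).
Qed.

(** The operator with kernel h and the operator with the transposed kernel are
    adjoint to each other.  Keeping f and g outside the inner integrals lets an
    inner integral with a known closed form be substituted on either side of
    the exchange. *)
Lemma tonelli_kernel (f : T1 -> \bar R) (g : T2 -> \bar R) :
  measurable_fun D1 f -> (forall x, D1 x -> 0 <= f x) ->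
  measurable_fun D2 g -> (forall y, D2 y -> 0 <= g y) ->
  \int[m1]_(x in D1) (f x * \int[m2]_(y in D2) (h (x, y) * g y)) =
  \int[m2]_(y in D2) (g y * \int[m1]_(x in D1) (h (x, y) * f x)).
Proof.
move=> mf f0 mg g0.
pose H := (fun z : T1 * T2 => f z.1 * (h z * g z.2)) \_ (D1 `*` D2).
have mfst : measurable_fun (D1 `*` D2) (f \o fst).
  apply: (@measurable_comp _ _ _ _ _ _ D1) => //.
    by move=> _ [z [? _] <-].
  by apply: measurable_funTS; exact: measurable_fst.
have msnd : measurable_fun (D1 `*` D2) (g \o snd).
  apply: (@measurable_comp _ _ _ _ _ _ D2) => //.
    by move=> _ [z [_ ?] <-].
  by apply: measurable_funTS; exact: measurable_snd.
have mH : measurable_fun setT H.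
  apply/(measurable_restrictT _ (measurableX mD1 mD2)).
  by apply: emeasurable_funM => //; exact: emeasurable_funM.
have H0 z : 0 <= H z.
  by apply: erestrict_ge0 => -[x y] [/= ? ?]; rewrite !mule_ge0 ?h0 ?g0 ?f0.
have := @fubini_tonelli _ _ _ _ _ m1 m2 H mH H0.
have -> : \int[m1]_x \int[m2]_y H (x, y) =
    \int[m1]_(x in D1) (f x * \int[m2]_(y in D2) (h (x, y) * g y)).
  rewrite [RHS]integral_mkcond; apply: eq_integral => x _; rewrite patchE.
  case: ifPn => xD1; last first.
    by rewrite integral0_eq// => y _; rewrite /H patchE in_setX (negbTE xD1).
  have D1x := set_mem xD1.
  rewrite -ge0_integralZl//.
  - rewrite [RHS]integral_mkcond; apply: eq_integral => y _.
    by rewrite /H !patchE in_setX xD1.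
  - apply: emeasurable_funM => //.
    apply: (measurable_comp (F := D1 `*` D2) (f := h) (g := pair x)) => //.
    + exact: measurableX.
    + by move=> _ [y D2y <-].
    + by apply: measurable_funTS; exact: pair1_measurable.
  - by move=> y D2y; rewrite mule_ge0 ?h0 ?g0.
  - exact: f0.
have -> : \int[m2]_y \int[m1]_x H (x, y) =
    \int[m2]_(y in D2) (g y * \int[m1]_(x in D1) (h (x, y) * f x)).
  rewrite [RHS]integral_mkcond; apply: eq_integral => y _; rewrite patchE.
  case: ifPn => yD2; last first.
    by rewrite integral0_eq// => x _; rewrite /H patchE in_setX (negbTE yD2) andbF.
  have D2y := set_mem yD2.
  rewrite -ge0_integralZl//.
  - rewrite [RHS]integral_mkcond; apply: eq_integral => x _.
    rewrite /H !patchE in_setX yD2 andbT; case: ifPn => // _.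
    by rewrite muleC [h _ * _]muleC -muleA.
  - apply: emeasurable_funM => //.
    apply: (measurable_comp (F := D1 `*` D2) (f := h) (g := pair^~ y)) => //.
    + exact: measurableX.
    + by move=> _ [x D1x <-].
    + by apply: measurable_funTS; exact: pair2_measurable.
  - by move=> x D1x; rewrite mule_ge0 ?h0 ?f0.
  - exact: g0.
by [].
Qed.

End tonelli_kernel.

(** * The kernel of the order relation *)

Section order_kernel.
Context (R : realType).
Local Notation mu := (@lebesgue_measure R).
(* The Lebesgue measure lives on this copy of R, so products are formed on it for
   their sigma-algebra to be the one of Tonelli's theorem. *)
Local Notation TR := (measurableTypeR R).

(** Integrating against this indicator of v <= s, in either variable, produces
    integrals over half-lines; this is how both u^a (an integral over [0, u])
    and min(s, u) become amenable to Tonelli's theorem. *)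
Definition order_kernel (z : R * R) : \bar R :=
  (\1_[set z : R * R | z.2 <= z.1] z)%:E.

Lemma order_kernel_ge0 z : (0 <= order_kernel z)%E.
Proof. by rewrite lee_fin. Qed.

Lemma measurable_order_kernel (A : set (TR * TR)) :
  measurable_fun A (order_kernel : TR * TR -> \bar R).
Proof.
apply: measurable_funTS; apply/measurable_EFinP; apply: measurable_indic.
have := @measurable_fun_ler _ _ R setT _ _ (@measurable_snd _ _ TR TR) (@measurable_fst _ _ TR TR).
move=> /(_ measurableT [set true] I); rewrite setTI.
by congr measurable; apply/seteqP; split => z /=.
Qed.

Lemma integral_order_kernel_above (D : set R) (f : R -> \bar R) (v : R) :
  (\int[mu]_(s in D) (order_kernel (s, v) * f s) =
   \int[mu]_(s in D `&` `[v, +oo[%classic) f s)%E.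
Proof.
rewrite integral_mkcondr; apply: eq_integral => s _.
rewrite epatch_indic /order_kernel/= muleC; congr (_ * (_)%:E)%E.
by rewrite !indicE; congr (nat_of_bool _)%:R; apply/idP/idP; rewrite !inE/= in_itv/= andbT.
Qed.

Lemma integral_order_kernel_below (D : set R) (f : R -> \bar R) (s : R) :
  (\int[mu]_(v in D) (order_kernel (s, v) * f v) =
   \int[mu]_(v in D `&` `]-oo, s]%classic) f v)%E.
Proof.
rewrite integral_mkcondr; apply: eq_integral => v _.
rewrite epatch_indic /order_kernel/= muleC; congr (_ * (_)%:E)%E.
Qed.

End order_kernel.

(** * The recurrence of the Gamma function *)

Lemma integral_expR_tail (R : realType) (v : R) :
  (\int[@lebesgue_measure R]_(u in `[v, +oo[) (expR (- u))%:E
    = (expR (- v))%:E)%E.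
Proof.
rewrite (@ge0_continuous_FTC2y _ _ (fun u => - expR (- u)) v 0)//.
- by rewrite -EFinB sub0r opprK.
- apply: continuous_subspaceT => x.
  apply: continuous_comp; [exact: opp_continuous|exact: continuous_expR].
- by rewrite -oppr0; apply: cvgN; exact: cvgr_expR.
- apply: cvgN; apply/cvg_at_right_filter.
  apply: continuous_comp; [exact: opp_continuous|exact: continuous_expR].
- by move=> x _; rewrite derive1E derive_val mulrN1 opprK.
Qed.

(** Write u^a / a as the integral of v^(a-1) over v <= u, and exchange the
    integrals: what remains is the tail integral of exp(-u) over u >= v, which
    is exp(-v).  The exchange equates extended nonnegative integrals; it passes
    to real values since a positive factor may be pulled out of [fine], even
    at +oo. *)
Lemma Gamma_recurrence (R : realType) (a : R) : 0 < a -> Gamma (a + 1) = a * Gamma a.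
Proof.
move=> a0; rewrite /Gamma addrK.
pose D : set R := `]0, +oo[%classic.
have mpow : measurable_fun D (fun v : R => (v `^ (a - 1))%:E).
  by apply/measurable_EFinP/measurable_funTS; exact: measurable_powR.
have mexp : measurable_fun D (fun u : R => (expR (- u))%:E).
  apply/measurable_EFinP; apply: (measurableT_comp (@measurable_expR R)).
  by apply: measurable_funTS; apply: continuous_measurable_fun; exact: opp_continuous.
have D0 (x : R) : D x -> 0 < x by rewrite /D/= in_itv/= andbT.
have inner u : D u ->
    (\int[@lebesgue_measure R]_(v in D) (order_kernel (u, v) * (v `^ (a - 1))%:E)
     = (u `^ a / a)%:E)%E.
  move=> /D0 u0; rewrite integral_order_kernel_below.
  have -> : D `&` `]-oo, u]%classic = `]0, u]%classic.
    by apply/seteqP; split => x; rewrite /D/= !in_itv/= andbT => /andP.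
  rewrite integral_itv_obnd_cbnd; last first.
    by apply/measurable_EFinP/measurable_funTS; exact: measurable_powR.
  by rewrite integral_powR0// ltW.
have outer v : D v ->
    (\int[@lebesgue_measure R]_(u in D) (order_kernel (u, v) * (expR (- u))%:E)
     = (expR (- v))%:E)%E.
  move=> /D0 v0; rewrite integral_order_kernel_above.
  have -> : D `&` `[v, +oo[%classic = `[v, +oo[%classic.
    apply/seteqP; split => x; rewrite /D/= !in_itv/= !andbT; first by case.
    by move=> vx; split=> //; exact: lt_le_trans vx.
  exact: integral_expR_tail.
have := @tonelli_kernel _ _ (measurableTypeR R) (measurableTypeR R) R (@lebesgue_measure R) (@lebesgue_measure R)
  D D (@order_kernel R) (measurable_itv _) (measurable_itv _)
  (@measurable_order_kernel R (D `*` D)) (fun _ _ _ _ => order_kernel_ge0 _)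
  (fun u => (expR (- u))%:E) (fun v => (v `^ (a - 1))%:E) mexp _ mpow _.
have exp0 (u : R) : D u -> (0 <= (expR (- u))%:E)%E by rewrite lee_fin expR_ge0.
have pow0 (v : R) : D v -> (0 <= (v `^ (a - 1))%R%:E)%E by rewrite lee_fin powR_ge0.
move=> /(_ exp0 pow0).
rewrite (eq_integral (fun u : measurableTypeR R => a^-1%:E * (u `^ a * expR (- u))%:E)%E); last first.
  move=> u /set_mem Du.
  by rewrite inner// -!EFinM; congr EFin; ring.
rewrite [RHS](eq_integral (fun v : measurableTypeR R => (v `^ (a - 1) * expR (- v))%:E)); last first.
  by move=> v /set_mem Dv; rewrite outer.
rewrite ge0_integralZl//; last 3 first.
- apply/measurable_EFinP/measurable_funM; last exact/measurable_EFinP.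
  by apply/measurable_funTS; exact: measurable_powR.
- by move=> u _; rewrite lee_fin mulr_ge0 ?powR_ge0 ?expR_ge0.
- by rewrite lee_fin invr_ge0 ltW.
rewrite /Rintegral => <-.
set I := integral _ _ _.
case: I => [r| |] /=.
- by rewrite mulrA divff ?mul1r// gt_eqF.
- by rewrite gt0_muley ?lte_fin ?invr_gt0//= mulr0.
- by rewrite gt0_muleNy ?lte_fin ?invr_gt0//= mulr0.
exact: measurable_itv.
Qed.

(** * The Riemann--Liouville kernel against the minimum *)

Section riemann_liouville_kernel.
Context (R : realType) (a t : R).
Hypotheses (a0 : 0 < a) (t0 : 0 <= t).
Local Notation mu := (@lebesgue_measure R).
Local Notation TR := (measurableTypeR R).

Let D : set R := `[0, t]%classic.
Let k (s : TR) : \bar R := ((t - s) `^ (a - 1))%R%:E.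

Let k0 s : (0 <= k s)%E. Proof. by rewrite lee_fin powR_ge0. Qed.

Let mk (A : set TR) : measurable_fun A k.
Proof. by apply/measurable_EFinP; exact: measurable_powR_sub. Qed.

Let mD : measurable (D : set TR). Proof. exact: measurable_itv. Qed.

Lemma integral_order_kernel_powR_sub (v : R) : D v ->
  (\int[mu]_(s in D) (order_kernel (s, v) * ((t - s) `^ (a - 1))%R%:E)
    = ((t - v) `^ a / a)%R%:E)%E.
Proof.
rewrite /D/= in_itv/= => /andP[v0 vt].
rewrite integral_order_kernel_above.
have -> : D `&` `[v, +oo[%classic = `[v, t]%classic.
  apply/seteqP; split => x; rewrite /D/= !in_itv/= !andbT.
    by case=> /andP[_ ->] ->.
  by move=> /andP[vx ->]; rewrite vx (le_trans v0).
exact: integral_powR_sub.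
Qed.

Lemma integral_order_kernel2 (s u : R) : D s -> D u ->
  (\int[mu]_(v in D) (order_kernel (u, v) * order_kernel (s, v))
    = (Num.min s u)%:E)%E.
Proof.
rewrite /D/= !in_itv/= => /andP[s0 st] /andP[u0 ut].
rewrite integral_order_kernel_below.
under eq_integral do rewrite -[order_kernel _]mule1.
rewrite integral_order_kernel_below.
rewrite integral_cst ?mul1e; last first.
  by apply: measurableI => //; apply: measurableI => //.
have -> : (D `&` `]-oo, u]%classic `&` `]-oo, s]%classic) = `[0, Num.min s u]%classic.
  apply/seteqP; split => x; rewrite /D/= !in_itv/= le_min.
    by case=> -[/andP[-> _] ->] ->.
  by move=> /and3P[-> xs ->]; rewrite xs (le_trans xs st).
rewrite [LHS]lebesgue_measure_itv/= lte_fin.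
case: ltP => [_|]; first by rewrite oppr0 adde0.
move=> h; congr EFin; apply/esym/eqP; rewrite eq_le h le_min s0 u0//.
Qed.

(** Expanding min(s, u) as an integral over v and applying Tonelli's theorem
    twice, once in u and once in s, leaves the integral of K(v)^2. *)
Lemma riemann_liouville_min_kernel :
  (\int[mu]_(s in D) (((t - s) `^ (a - 1))%R%:E *
     \int[mu]_(u in D) (((t - u) `^ (a - 1))%R%:E * (Num.min s u)%:E))
   = (t `^ (2 * a + 1) / ((2 * a + 1) * a ^+ 2))%R%:E)%E.
Proof.
pose K (v : TR) : \bar R := ((t - v) `^ a / a)%R%:E.
have K0 v : (0 <= K v)%E by rewrite lee_fin divr_ge0 ?powR_ge0 ?ltW.
have mK (A : set TR) : measurable_fun A K.
  by apply/measurable_EFinP/measurable_funM => //; exact: measurable_powR_sub.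
have ton := @tonelli_kernel _ _ TR TR R mu mu
  D D (@order_kernel R) mD mD
  (@measurable_order_kernel R (D `*` D)) (fun _ _ _ _ => order_kernel_ge0 _).
rewrite (eq_integral (fun s : TR => k s *
    \int[mu]_(v in D) (order_kernel (s, v) * K v))%E); last first.
  move=> s /set_mem Ds; congr (_ * _)%E.
  rewrite (eq_integral (fun u : TR => k u *
    \int[mu]_(v in D) (order_kernel (u, v) * order_kernel (s, v)))%E); last first.
    by move=> u /set_mem Du; rewrite integral_order_kernel2.
  rewrite (ton k (fun v => order_kernel (s, v))).
  - by apply: eq_integral => v /set_mem Dv; rewrite integral_order_kernel_powR_sub.
  - exact: mk.
  - by [].
  - apply: (measurableT_comp (@measurable_order_kernel R setT)).
    by apply: measurable_funTS; exact: pair1_measurable.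
  - by move=> v _; exact: order_kernel_ge0.
rewrite (ton k K)//.
rewrite (eq_integral (fun v : TR => (a ^- 2)%:E * ((t - v) `^ (2 * a + 1 - 1))%R%:E)%E); last first.
  move=> v /set_mem Dv; rewrite integral_order_kernel_powR_sub// -!EFinM.
  congr EFin; rewrite addrK (mulrC 2) powRrM (powR_mulrn 2) ?powR_ge0//.
  by field; rewrite gt_eqF.
rewrite ge0_integralZl//.
- rewrite integral_powR_sub ?subr0//; last by rewrite addr_gt0// mulr_gt0.
  rewrite -EFinM; congr EFin; field.
  by rewrite !gt_eqF// addr_gt0// mulr_gt0.
- by apply/measurable_EFinP; exact: measurable_powR_sub.
- by move=> v _; rewrite lee_fin powR_ge0.
- by rewrite lee_fin invr_ge0 exprn_ge0// ltW.
Qed.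

End riemann_liouville_kernel.

(** * Moments of natural-valued random variables *)

Section nat_random_variable.
Local Open Scope ereal_scope.
Context d (T : measurableType d) (R : realType) (P : probability T R).

Lemma measurable_fun_of_nat (X : T -> nat) (f : nat -> \bar R) :
  measurable_fun setT X -> measurable_fun setT (f \o X).
Proof. by move=> mX; apply: measurableT_comp. Qed.

Lemma measurable_nat_fiber (X : T -> nat) k :
  measurable_fun setT X -> measurable (X @^-1` [set k]).
Proof. by move=> mX; rewrite -[X in measurable X]setTI; exact: mX. Qed.

Lemma ge0_integral_nat_fibers (X : T -> nat) (A : set T) (h : T -> \bar R) :
  measurable_fun setT X -> measurable A -> measurable_fun setT h ->
  (forall w, 0 <= h w) ->
  \int[P]_(w in A) h w = \sum_(k <oo) \int[P]_(w in A `&` X @^-1` [set k]) h w.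
Proof.
move=> mX mA mh h0.
have AE : A = \bigcup_k (A `&` X @^-1` [set k]).
  apply/seteqP; split => [w Aw|w [k _ []]//]; by exists (X w).
rewrite [in LHS]AE ge0_integral_bigcup//.
- by move=> k; apply: measurableI => //; exact: measurable_nat_fiber.
- exact: measurable_funTS.
- apply/trivIsetP => i j _ _ /eqP ij; apply/seteqP; split => // w [[_ /= Xi] [_ /= Xj]].
  by apply: ij; rewrite -Xi -Xj.
Qed.

Lemma ge0_integral_nat_law (X : T -> nat) (A : set T) (f : nat -> \bar R) :
  measurable_fun setT X -> measurable A -> (forall k, 0 <= f k) ->
  \int[P]_(w in A) f (X w) =
  \sum_(k <oo) f k * P (A `&` X @^-1` [set k]).
Proof.
move=> mX mA f0; rewrite (ge0_integral_nat_fibers mX)//; last first.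
  exact: (measurable_fun_of_nat f mX).
apply: eq_eseriesr => k _.
rewrite (eq_integral (cst (f k))); last by move=> w /set_mem[_ /= ->].
by rewrite integral_cst//; apply: measurableI => //; exact: measurable_nat_fiber.
Qed.

(** Summing over the values of X, and for each of them over the values of Y,
    reduces the claim to the product rule on the fibers. *)
Lemma ge0_integral_indep_nat (X Y : T -> nat) (f g : nat -> \bar R) :
  measurable_fun setT X -> measurable_fun setT Y ->
  (forall k, 0 <= f k) -> (forall k, 0 <= g k) ->
  (forall i j, P (X @^-1` [set i] `&` Y @^-1` [set j]) =
    P (X @^-1` [set i]) * P (Y @^-1` [set j])) ->
  \int[P]_w (f (X w) * g (Y w)) = (\int[P]_w f (X w)) * (\int[P]_w g (Y w)).
Proof.
move=> mX mY f0 g0 XY.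
rewrite (ge0_integral_nat_fibers mX)//; last 2 first.
- by apply: emeasurable_funM; exact: measurable_fun_of_nat.
- by move=> w; rewrite mule_ge0.
rewrite muleC -ge0_integralZl//; last 2 first.
- exact: (measurable_fun_of_nat f mX).
- by apply: integral_ge0 => w _; exact: g0.
set c := \int[P]_w g (Y w).
have c0 : 0 <= c by apply: integral_ge0 => w _; exact: g0.
rewrite (ge0_integral_nat_law (f := fun k => c * f k) mX)//; last first.
  by move=> k; rewrite mule_ge0.
apply: eq_eseriesr => i _; rewrite setTI.
have mXi : measurable (X @^-1` [set i]) by exact: measurable_nat_fiber.
rewrite (eq_integral (fun w => f i * g (Y w))); last first.
  by move=> w /set_mem /= ->.
rewrite ge0_integralZl//; last first.
  by apply: measurable_funTS; exact: (measurable_fun_of_nat g mY).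
rewrite (ge0_integral_nat_law mY)//.
rewrite (muleC c) -muleA; congr (_ * _).
rewrite muleC /c -ge0_integralZl//; last exact: (measurable_fun_of_nat g mY).
rewrite (ge0_integral_nat_law (f := fun j => P (X @^-1` [set i]) * g j) mY)//; last first.
  by move=> k; rewrite mule_ge0.
apply: eq_eseriesr => j _; rewrite setTI [in LHS]XY.
by rewrite muleCA muleA.
Qed.

(** The Stein--Chen identity.  It shifts the series for E[X f(X)] by one index,
    using (k + 1) p(k + 1) = m p(k); with f = 1 and f = id it yields the first
    two moments. *)
Lemma poisson_stein (X : T -> nat) (m : R) (f : nat -> R) : (0 < m)%R ->
  measurable_fun setT X ->
  (forall k, P (X @^-1` [set k]) = (poisson_pmf m k)%:E) ->
  (forall k, 0 <= f k)%R ->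
  \int[P]_w ((X w)%:R * f (X w))%:E = m%:E * \int[P]_w (f (X w).+1)%:E.
Proof.
move=> m0 mX PX f0.
rewrite (ge0_integral_nat_law (f := fun k => (k%:R * f k)%:E) mX)//; last first.
  by move=> k; rewrite lee_fin mulr_ge0.
rewrite (ge0_integral_nat_law (f := fun k => (f k.+1)%:E) mX)//; last first.
  by move=> k; rewrite lee_fin.
rewrite nneseries_recl//; last by move=> k _; rewrite mule_ge0// lee_fin mulr_ge0.
rewrite mul0r mul0e add0e -nneseriesZl; last by move=> k _; rewrite mule_ge0// lee_fin.
rewrite -[1%N]add0n -nneseries_addn; last first.
  by move=> k; rewrite mule_ge0// lee_fin mulr_ge0.
apply: eq_eseriesr => k _; rewrite !setTI !PX -!EFinM; congr EFin.
rewrite !addn1 /poisson_pmf m0 exprS factS natrM.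
by field; rewrite pnatr_eq0 -lt0n fact_gt0 nat1r pnatr_eq0.
Qed.

End nat_random_variable.

(** * First and second moments of the Poisson process *)

Section poisson_moments.
Local Open Scope ereal_scope.
Context d (T : measurableType d) (R : realType) (P : probability T R).
Variables (lambda : R) (N : R -> {RV P >-> nat}).
Hypotheses (lambda0 : (0 < lambda)%R) (hN : poisson_process lambda N).

Let measurable_increment s t : measurable_fun setT (fun w => N t w - N s w)%N.
Proof. by apply: measurable_fun_subn; exact: measurable_funPT. Qed.

Lemma expectation_poisson_increment s t : (0 <= s)%R -> (s <= t)%R ->
  \int[P]_w ((N t w - N s w)%N%:R)%:E = (lambda * (t - s))%:E.
Proof.
move=> s0; rewrite le_eqVlt => /predU1P[<-|st].
  rewrite subrr mulr0; apply: integral0_eq => w _.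
  by rewrite subnn.
have m0 : (0 < lambda * (t - s))%R by rewrite mulr_gt0// subr_gt0.
have := poisson_stein (f := fun=> 1%R) m0 (measurable_increment s t)
  (poisson_increments hN s0 st) (fun=> ler01).
rewrite [X in _ = _ * X](_ : _ = 1) ?mule1; last first.
  by rewrite integral_cst// [X in _ * X]probability_setT mul1e.
move=> <-.
by apply: eq_integral => w _; rewrite mulr1.
Qed.

Lemma expectation_poisson s : (0 <= s)%R ->
  \int[P]_w ((N s w)%:R)%:E = (lambda * s)%:E.
Proof.
move=> s0; rewrite -[s in RHS]subr0 -(expectation_poisson_increment (lexx 0) s0).
by apply: eq_integral => w _; rewrite (poisson_start hN) subn0.
Qed.

Lemma expectation_poisson_sqr s : (0 <= s)%R ->
  \int[P]_w ((N s w)%:R * (N s w)%:R)%:E = (lambda * s + (lambda * s) ^+ 2)%:E.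
Proof.
rewrite le_eqVlt => /predU1P[<-|s0].
  rewrite mulr0 add0r expr0n; apply: integral0_eq => w _.
  by rewrite (poisson_start hN) mul0r.
have m0 : (0 < lambda * s)%R by rewrite mulr_gt0.
have PX k : P (N s @^-1` [set k]) = (poisson_pmf (lambda * s) k)%:E.
  rewrite -[s in RHS]subr0 -(poisson_increments hN (lexx 0) s0 k); congr (P _).
  by apply/seteqP; split => w /=; rewrite (poisson_start hN) subn0.
rewrite (poisson_stein (f := fun n => n%:R) m0 (measurable_funPT _) PX)//.
under eq_integral do rewrite -natr1 EFinD.
rewrite ge0_integralD//; last first.
  exact: (measurable_fun_of_nat (fun n => n%:R%:E) (measurable_funPT _)).
rewrite expectation_poisson ?ltW// integral_cst// [X in _ * (_ + _ * X)]probability_setT mul1e -EFinD -EFinM; congr EFin.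
by ring.
Qed.

Lemma expectation_poisson_mul s u : (0 <= s)%R -> (0 <= u)%R ->
  \int[P]_w ((N s w)%:R * (N u w)%:R)%:E =
  (lambda * Num.min s u + (lambda * s) * (lambda * u))%:E.
Proof.
wlog su : s u / (s <= u)%R.
  move=> H s0 u0; have /orP[su|us] := le_total s u; first exact: H.
  rewrite minC (mulrC (lambda * s)%R) -H//.
  by apply: eq_integral => w _; rewrite mulrC.
move=> s0 u0; rewrite min_l//.
(* The partition 0 <= s <= u, continued constantly, makes N(s) and N(u) - N(s)
   the first two increments. *)
pose tau n : R := if n == 0%N then 0%R else if n == 1%N then s else u.
have indep i j : P (N s @^-1` [set i] `&` (fun w => N u w - N s w)%N @^-1` [set j]) =
    P (N s @^-1` [set i]) * P ((fun w => N u w - N s w)%N @^-1` [set j]).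
  have tau_nd n : (tau n <= tau n.+1)%R by case: n => [|[|n]].
  pose A (k : 'I_2) : set nat := if k == ord0 then [set i] else [set j].
  have := poisson_independent_increments hN (n := 2%N) (lexx 0 : (0 <= tau 0%N)%R) tau_nd.
  move=> /(_ A (fun _ => I)); rewrite big_ord_recl big_ord1.
  have -> : [set w | forall k : 'I_2, A k (N (tau k.+1) w - N (tau k) w)%N] =
      N s @^-1` [set i] `&` (fun w => N u w - N s w)%N @^-1` [set j].
    apply/seteqP; split => [w h|w [h1 h2] [[|[|//]] ?]].
    - split; first by have := h ord0; rewrite /A/= (poisson_start hN) subn0.
      by have := h (lift ord0 ord0).
    - by rewrite /A/= (poisson_start hN) subn0.
    - by rewrite /A.
  move=> ->; congr (P _ * P _).
  by apply/seteqP; split => w; rewrite /A/= (poisson_start hN) subn0.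
rewrite (eq_integral (fun w => ((N s w)%:R * (N s w)%:R)%:E +
    ((N s w)%:R)%:E * ((N u w - N s w)%N%:R)%:E)); last first.
  move=> w _; rewrite -!EFinM -EFinD; congr EFin.
  by rewrite natrB ?(poisson_nondecreasing hN)//; ring.
rewrite ge0_integralD//; last 2 first.
- apply: (measurable_fun_of_nat (fun n => (n%:R * n%:R)%:E)); exact: measurable_funPT.
- apply: emeasurable_funM.
  + by apply: (measurable_fun_of_nat (fun n => n%:R%:E)); exact: measurable_funPT.
  + exact: (measurable_fun_of_nat (fun n => n%:R%:E)).
rewrite expectation_poisson_sqr//.
rewrite (ge0_integral_indep_nat (f := fun n => n%:R%:E) (g := fun n => n%:R%:E)
  (measurable_funPT _) (measurable_increment s u) _ _ indep)//.
rewrite expectation_poisson// expectation_poisson_increment//.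
by rewrite -EFinM -EFinD; congr EFin; ring.
Qed.

End poisson_moments.

(** * Joint measurability of the Poisson process *)

Lemma measurable_fun_nat_le d (T : measurableType d) (D : set T) (X : T -> nat) :
  (forall m, measurable (D `&` [set z | (X z <= m)%N])) ->
  measurable_fun D X.
Proof.
move=> H mD; apply: (measurability _ NGenCInfty.measurableE) => //.
move=> _ [_ [[|m] ->] <-].
  rewrite (_ : X @^-1` _ = setT) ?setIT//.
  by apply/seteqP; split => z //= _; rewrite in_itv/=.
rewrite (_ : D `&` _ = D `\` (D `&` [set z | (X z <= m)%N])); first exact: measurableD.
apply/seteqP; split => z /=; rewrite in_itv/= andbT leEnat.
  by case=> Dz mX; split => // -[_]; rewrite leqNgt mX.
by case=> Dz h; split => //; rewrite ltnNge; apply/negP => Xm; apply: h.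
Qed.

Section poisson_joint_measurability.
Context d (T : measurableType d) (R : realType) (P : probability T R).
Variables (lambda : R) (N : R -> {RV P >-> nat}).
Hypotheses (hN : poisson_process lambda N).
Local Notation TR := (measurableTypeR R).

(** A path with values in a discrete space that is right continuous at s is
    constant just after s, so the bound at s persists at some later rational
    time; conversely monotonicity carries the bound back to s.  Hence
    [N s w <= m] becomes a countable union of product conditions on s and w. *)
Lemma poisson_le_rational (s : R) (w : T) m : 0 <= s ->
  (N s w <= m)%N <-> exists2 r : rat, s < ratr r & (N (ratr r) w <= m)%N.
Proof.
move=> s0; split=> [sm|[r sr rm]]; last first.
  by rewrite (leq_trans _ rm)// (poisson_nondecreasing hN)// ltW.
have : \forall x \near s^'+, N x w = N s w.
  have /(_ [set N s w]) := poisson_right_continuous hN (w := w) s0.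
  by apply; apply/principal_filterP.
rewrite near_withinE => /nbhs_ballP[e /= e0 he].
have : s < s + e by rewrite ltrDl.
move=> /rat_in_itvoo[r]; rewrite in_itv/= => /andP[sr re].
exists r => //; rewrite he// /ball/= distrC gtr0_norm ?subr_gt0//; lra.
Qed.

Lemma measurable_poisson_process (D : set TR) : measurable D ->
  (forall s, D s -> 0 <= s) ->
  measurable_fun (setT `*` D : set (T * TR)) (fun z => N z.2 z.1).
Proof.
move=> mD D0; apply: measurable_fun_nat_le => m.
have -> : (setT `*` D) `&` [set z : T * TR | (N z.2 z.1 <= m)%N] =
    \bigcup_(r : rat) ([set w | (N (ratr r) w <= m)%N] `*` (D `&` `]-oo, ratr r[%classic)).
  apply/seteqP; split => [[w s] /= [[_ Ds]]|[w s] [r _ [/= + [Ds]]]].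
    rewrite poisson_le_rational ?D0// => -[r sr rm].
    by exists r => //; split => //; split => //=; rewrite in_itv.
  rewrite in_itv/= => rm sr; split => //.
  by rewrite poisson_le_rational ?D0//; exists r.
apply: bigcupT_measurable_rat => r; apply: measurableX; last exact: measurableI.
have := @measurable_funPT _ _ _ _ (N (ratr r)) measurableT [set n | (n <= m)%N] I.
by rewrite setTI.
Qed.

End poisson_joint_measurability.

(** * The variance of the fractional integral *)

Lemma variance_scale_moments d (T : measurableType d) (R : realType)
    (P : probability T R) (Z : T -> R) (c e q : R) :
  measurable_fun setT Z ->
  (\int[P]_w (Z w)%:E = e%:E)%E ->
  (\int[P]_w (Z w * Z w)%:E = q%:E)%E ->
  variance P (fun w => c * Z w) = (c ^+ 2 * (q - e ^+ 2))%:E.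
Proof.
move=> mZ Ze Zq.
have ZL : Z \in Lfun P 2%:E.
  rewrite inE; apply/andP; split; rewrite inE//=.
  rewrite /finite_norm unlock poweR_lty//=.
  rewrite (eq_integral (fun w => (Z w * Z w)%:E)) ?Zq ?ltry// => w _.
  by rewrite /= (powR_mulrn 2)// real_normK ?num_real// expr2.
have -> : (fun w => c * Z w) = (c \o* Z)%R by apply/funext => w /=; rewrite mulrC.
rewrite varianceZ// varianceE//.
rewrite unlock Ze (_ : \int[P]_w _ = q%:E)%E; last first.
  by rewrite -Zq; apply: eq_integral => w _; rewrite /= expr2.
by rewrite -EFinB -EFinM.
Qed.

Lemma ge0_integral_lincomb d (T : measurableType d) (R : realType)
    (m : {measure set T -> \bar R}) (D : set T) (b c : \bar R) (f g : T -> \bar R) :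
  measurable D -> (0 <= b)%E -> (0 <= c)%E ->
  measurable_fun D f -> (forall x, D x -> 0 <= f x)%E ->
  measurable_fun D g -> (forall x, D x -> 0 <= g x)%E ->
  (\int[m]_(x in D) (b * f x + c * g x) =
   b * \int[m]_(x in D) f x + c * \int[m]_(x in D) g x)%E.
Proof.
move=> mD b0 c0 mf f0 mg g0.
rewrite ge0_integralD//.
- by rewrite !ge0_integralZl.
- by move=> x Dx; rewrite mule_ge0 ?f0.
- exact: emeasurable_funM.
- by move=> x Dx; rewrite mule_ge0 ?g0.
- exact: emeasurable_funM.
Qed.

Section fractional_poisson_moments.
Local Open Scope ereal_scope.
Context d (T : measurableType d) (R : realType) (P : probability T R).
Variables (lambda : R) (N : R -> {RV P >-> nat}) (a t : R).
Hypotheses (lambda0 : (0 < lambda)%R) (hN : poisson_process lambda N).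
Hypotheses (a0 : (0 < a)%R) (t0 : (0 <= t)%R).
Local Notation mu := (@lebesgue_measure R).
Local Notation TR := (measurableTypeR R).

Let D : set TR := `[0%R, t]%classic.
Let k (s : TR) : \bar R := ((t - s) `^ (a - 1))%R%:E.
Let h (z : T * TR) : \bar R := ((N z.2 z.1)%:R)%:E.
Let J (w : T) : \bar R := \int[mu]_(s in D) (h (w, s) * k s).

Let mD : measurable D. Proof. exact: measurable_itv. Qed.

Let D_ge0 s : D s -> (0 <= s)%R.
Proof. by rewrite /D/= in_itv/= => /andP[]. Qed.

Let D_le s : D s -> (s <= t)%R.
Proof. by rewrite /D/= in_itv/= => /andP[]. Qed.

Let k0 s : 0 <= k s. Proof. by rewrite lee_fin powR_ge0. Qed.

Let h0 z : 0 <= h z. Proof. by rewrite lee_fin. Qed.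

Let J0 w : 0 <= J w. Proof. by apply: integral_ge0 => s _; rewrite mule_ge0. Qed.

Let mk (A : set TR) : measurable_fun A k.
Proof. by apply/measurable_EFinP; exact: measurable_powR_sub. Qed.

Let mh : measurable_fun (setT `*` D) h.
Proof.
apply: (measurable_comp (F := setT) (f := fun n : nat => (n%:R)%:E : \bar R)) => //.
exact: (measurable_poisson_process hN mD D_ge0).
Qed.

Let mhs s : measurable_fun setT (fun w => h (w, s)).
Proof. exact: (measurable_fun_of_nat (X := N s) (fun n => n%:R%:E) (measurable_funPT _)). Qed.

Lemma measurable_fractional_poisson : measurable_fun setT J.
Proof.
have := @measurable_fun_integral_kernel _ _ T TR R mu setT D h measurableT mD mh.
by apply => //; exact: mk.
Qed.

(** Every expectation below reduces to this exchange: Y = 1 gives the mean of J,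
   and Y = J followed by Y = N(s) gives its second moment. *)
Let tonelli (Y : T -> \bar R) : measurable_fun setT Y -> (forall w, 0 <= Y w) ->
  \int[P]_w (Y w * J w) = \int[mu]_(s in D) (k s * \int[P]_w (h (w, s) * Y w)).
Proof.
move=> mY Y0.
exact: (@tonelli_kernel _ _ T TR R P mu setT D h measurableT mD mh).
Qed.

Let EJ := \int[mu]_(s in D) (k s * (lambda * s)%:E).

Lemma expectation_fractional_poisson : \int[P]_w J w = EJ.
Proof.
transitivity (\int[P]_w (cst 1 w * J w)).
  by apply: eq_integral => w _; rewrite mul1e.
rewrite tonelli//; apply: eq_integral => s /set_mem Ds; congr (_ * _).
rewrite -(expectation_poisson lambda0 hN (D_ge0 Ds)).
by apply: eq_integral => w _; rewrite mule1.
Qed.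

Let intk : \int[mu]_(s in D) k s = (t `^ a / a)%R%:E.
Proof. by rewrite integral_powR_sub// subr0. Qed.

(** The kernel k is integrable on [0, t] but unbounded when a < 1, so finiteness
   is obtained for bounded functions integrated against it. *)
Let bounded_fin_num (g : TR -> \bar R) (c : R) : measurable_fun D g ->
  (forall s, D s -> 0 <= g s <= c%:E) ->
  \int[mu]_(s in D) (g s * k s) \is a fin_num.
Proof.
move=> mg g0c; have [g0 gc] : (forall s, D s -> 0 <= g s) /\ (forall s, D s -> g s <= c%:E).
  by split => s /g0c /andP[].
have c0 : (0 <= c)%R.
  have D0 : D 0%R by rewrite /D/= in_itv/= lexx.
  by rewrite -lee_fin (le_trans (g0 _ D0)) ?gc.
rewrite ge0_fin_numE; last by apply: integral_ge0 => s Ds; rewrite mule_ge0 ?g0.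
apply: (@le_lt_trans _ _ (\int[mu]_(s in D) (c%:E * k s))).
  apply: ge0_le_integral => //.
  - by move=> s Ds; rewrite mule_ge0 ?g0.
  - exact: emeasurable_funM.
  - by apply: emeasurable_funM => //; exact: mk.
  - by move=> s Ds; rewrite lee_wpmul2r ?gc.
by rewrite ge0_integralZl// intk -EFinM ltry.
Qed.

Let mlin (A : set TR) c : measurable_fun A (fun s : TR => (c * s)%R%:E).
Proof.
apply/measurable_EFinP; apply: measurable_funTS; apply: continuous_measurable_fun => x.
by apply: cvgM => //; exact: cvg_cst.
Qed.

Lemma expectation_fractional_poisson_fin_num : EJ \is a fin_num.
Proof.
rewrite /EJ; under eq_integral do rewrite muleC.
apply: (@bounded_fin_num _ (lambda * t)) => [|s Ds]; first exact: mlin.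
rewrite !lee_fin; apply/andP; split.
  by apply: mulr_ge0; [exact: ltW|exact: D_ge0].
by rewrite ler_pM2l//; exact: D_le.
Qed.

Lemma fractional_poisson_fin_num w : J w \is a fin_num.
Proof.
apply: (@bounded_fin_num _ (N t w)%:R) => [|s Ds].
  apply: (measurable_comp (measurableX measurableT mD) _ mh) => //.
    by move=> _ [s Ds <-].
  by apply: measurable_funTS; exact: pair1_measurable.
by rewrite h0 lee_fin ler_nat (poisson_nondecreasing hN) ?D_ge0 ?D_le.
Qed.

(** The two terms correspond to the splitting
    E[N(s) N(u)] = lambda min(s, u) + E[N(s)] E[N(u)]: the second one integrates
    to the square of the mean and the first one is the variance. *)
Lemma expectation_fractional_poisson_sqr :
  \int[P]_w (J w * J w) =
  (lambda * (t `^ (2 * a + 1) / ((2 * a + 1) * a ^+ 2)))%R%:E + EJ * EJ.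
Proof.
pose M (s : TR) := \int[mu]_(u in D) (k u * (Num.min s u)%:E).
have M0 s : D s -> 0 <= M s.
  move=> Ds; apply: integral_ge0 => u Du; rewrite mule_ge0// lee_fin le_min.
  by rewrite !D_ge0.
have mM : measurable_fun D M.
  have mm : measurable_fun (D `*` D) (fun z : TR * TR => (Num.min z.1 z.2)%:E : \bar R).
    apply/measurable_EFinP; apply: measurable_funTS.
    by apply: measurable_minr; [exact: measurable_fst|exact: measurable_snd].
  have := @measurable_fun_integral_kernel _ _ TR TR R mu D D _ mD mD mm.
  rewrite /M => H; under eq_fun do under eq_integral do rewrite muleC.
  apply: H => //.
  by move=> x y Dx Dy; rewrite lee_fin le_min !D_ge0.
have EJ0 : 0 <= EJ.
  apply: integral_ge0 => s Ds; rewrite mule_ge0// lee_fin mulr_ge0 ?(ltW lambda0)//.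
  exact: D_ge0.
rewrite tonelli//; last exact: measurable_fractional_poisson.
rewrite (eq_integral (fun s => lambda%:E * (k s * M s) + EJ * (k s * (lambda * s)%:E))); last first.
  move=> s /set_mem Ds.
  rewrite tonelli//.
  rewrite (eq_integral (fun u => lambda%:E * (k u * (Num.min s u)%:E) +
      (lambda * s)%:E * (k u * (lambda * u)%:E))); last first.
    move=> u /set_mem Du.
    have -> : \int[P]_w (h (w, u) * h (w, s)) =
        (lambda * Num.min s u + (lambda * s) * (lambda * u))%:E.
      rewrite -(expectation_poisson_mul lambda0 hN (D_ge0 Ds) (D_ge0 Du)).
      by apply: eq_integral => w _; rewrite muleC.
    by rewrite /k -!EFinM -EFinD; congr EFin; ring.
  rewrite ge0_integral_lincomb//.
  - rewrite -/(M s) -/EJ ge0_muleDr.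
    + by rewrite muleCA [X in _ + X]muleA [X in _ + X]muleC.
    + by rewrite mule_ge0 ?M0// lee_fin ltW.
    + by rewrite mule_ge0// lee_fin mulr_ge0 ?(ltW lambda0)//; exact: D_ge0.
  - by rewrite lee_fin ltW.
  - by rewrite lee_fin mulr_ge0 ?(ltW lambda0)//; exact: D_ge0.
  - apply: emeasurable_funM => //; apply/measurable_EFinP.
    by apply: measurable_minr => //; exact: measurable_id.
  - by move=> u Du; rewrite mule_ge0// lee_fin le_min !D_ge0.
  - exact: emeasurable_funM.
  - move=> u Du; rewrite mule_ge0// lee_fin mulr_ge0 ?(ltW lambda0)//.
    exact: D_ge0.
rewrite ge0_integral_lincomb//.
- by rewrite -/EJ (riemann_liouville_min_kernel a0 t0) -EFinM.
- by rewrite lee_fin ltW.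
- exact: emeasurable_funM.
- by move=> s Ds; rewrite mule_ge0 ?M0.
- exact: emeasurable_funM.
- move=> s Ds; rewrite mule_ge0// lee_fin mulr_ge0 ?(ltW lambda0)//.
  exact: D_ge0.
Qed.

Lemma variance_riemann_liouville_poisson :
  variance P (fun w : T => riemann_liouville a (fun s : R => (N s w)%:R) t) =
  ((Gamma a)^-1 ^+ 2 *
    (lambda * (t `^ (2 * a + 1) / ((2 * a + 1) * a ^+ 2))))%R%:E.
Proof.
have fineJ w : (fine (J w))%:E = J w by rewrite fineK// fractional_poisson_fin_num.
have -> : (fun w => riemann_liouville a (fun s => (N s w)%:R) t) =
    (fun w => (Gamma a)^-1 * fine (J w))%R.
  apply/funext => w; rewrite /riemann_liouville /Rintegral; congr (_ * fine _)%R.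
  by apply: eq_integral => s _; rewrite /k /h -EFinM mulrC.
have mean : \int[P]_w (fine (J w))%:E = (fine EJ)%:E.
  rewrite fineK ?expectation_fractional_poisson_fin_num//.
  by rewrite -expectation_fractional_poisson; apply: eq_integral => w _.
have sqr : \int[P]_w (fine (J w) * fine (J w))%:E =
    (lambda * (t `^ (2 * a + 1) / ((2 * a + 1) * a ^+ 2)) + fine EJ ^+ 2)%R%:E.
  rewrite EFinD [X in _ + X](_ : _ = EJ * EJ); last first.
    by rewrite expr2 EFinM fineK// expectation_fractional_poisson_fin_num.
  rewrite -expectation_fractional_poisson_sqr; apply: eq_integral => w _.
  by rewrite EFinM fineJ.
rewrite (variance_scale_moments (Z := fine \o J) _ _ mean sqr) ?addrK//.
apply: measurableT_comp; last exact: measurable_fractional_poisson.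
exact: fine_measurable.
Qed.

End fractional_poisson_moments.

Unset Implicit Arguments.

Theorem theorem3p1 (d : measure_display) (T : measurableType d) (R : realType)
    (P : probability T R) (lambda : R) (N : R -> {RV P >-> nat})
    (hlambda : 0 < lambda) (hN : poisson_process lambda N)
    (alpha : R) (halpha : 0 < alpha) (t : R) (ht : 0 <= t) :
  variance P
    (fun w : T => riemann_liouville alpha (fun s : R => (N s w)%:R) t) =
  (lambda * t `^ (2 * alpha + 1)
     / ((2 * alpha + 1) * Gamma (alpha + 1) ^+ 2))%:E.
Proof.
rewrite (variance_riemann_liouville_poisson hlambda hN halpha ht); congr EFin.
rewrite (Gamma_recurrence halpha) exprMn !exprVn !invfM.
by ring.
Qed.
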